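(* There exists no strongly separative refinement monoid $M$ such that $\nabla(M)\cong S_{\omega_1}$. In particular, there exists no interpolation group (thus, no dimension group) $G$ such that $\nabla(G^+)\cong S_{\omega_1}$.
   Context: All monoids are commutative and written additively. A commutative monoid $M$ is endowed with its algebraic quasi-ordering: $x\leq y$ iff there is $z\in M$ with $x+z=y$. $\mathbb{N}$ denotes the set of positive integers. $M$ is strongly separative if $a+b=2b$ implies $a=b$, for all $a,b\in M$. $M$ is a refinement monoid if $a_0+a_1=b_0+b_1$ in $M$ implies the existence of $c_{i,j}\in M$ ($i,j<2$) with $a_i=c_{i,0}+c_{i,1}$ and $b_i=c_{0,i}+c_{1,i}$ for all $i<2$. For a partially ordered abelian group $G$, $G^+$ denotes its positive cone. $G$ is an interpolation group if $G^+$ is a refinement monoid. $G$ is directed if $G=G^++(-G^+)$, and unperforated if $mx\geq 0$ implies $x\geq 0$ for all $m\in\mathbb{N}$, $x\in G$. A dimension group is an unperforated directed interpolation group. Put $a\propto b$ iff $a\leq nb$ for some $n\in\mathbb{N}$, and $a\asymp b$ iff $a\propto b$ and $b\propto a$. Then $\asymp$ is a monoid congruence and $\nabla(M)=M/{\asymp}$ is a join-semilattice with zero (join induced by $+$), the maximal semilattice quotient of $M$. The semilattice $S_{\omega_1}$: ordinals are identified with the set of smaller ordinals. Let $\mathcal{B}_{\omega_1}$ be the Boolean subalgebra of the powerset of $\omega_1$ generated by all intervals of $\omega_1$. Put $\mathcal{I}_{\omega_1}=\{x\in\mathcal{B}_{\omega_1}\mid \exists\alpha<\omega_1,\ x\subseteq\alpha\}$,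 $\mathcal{F}_{\omega_1}=\{x\in\mathcal{B}_{\omega_1}\mid \exists\alpha<\omega_1,\ \omega_1\setminus\alpha\subseteq x\}$, $D_{\omega_1}=\{x\subseteq\omega_1\mid x\text{ is finite or }x=\omega_1\}$, and $D_{\omega_1}^-=D_{\omega_1}\setminus\{\varnothing\}$. Then $S_{\omega_1}=(\{\varnothing\}\times\mathcal{I}_{\omega_1})\cup(D_{\omega_1}^-\times\mathcal{F}_{\omega_1})$, ordered by componentwise inclusion; it is a distributive join-semilattice with $0$ and $1$ (joins are componentwise unions). *)

(* Defs.v *)
From HB Require Import structures.
From mathcomp Require Import all_boot all_order all_algebra.
From mathcomp Require Import all_classical wochoice.

Set Implicit Arguments.
Unset Strict Implicit.
Unset Printing Implicit Defensive.

Import Order.TTheory GRing.Theory Num.Theory.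

Local Open Scope quotient_scope.
Local Open Scope classical_set_scope.
Local Open Scope ring_scope.

Section Monoids.
Variable M : nmodType.
Implicit Types a b c : M.

Definition alg_le a b := exists c, a + c = b.

Definition propto a b := exists n : nat, (0 < n)%N /\ alg_le a (b *+ n).

Definition asymp a b := propto a b /\ propto b a.

Definition strongly_separative := forall a b, a + b = b *+ 2 -> a = b.

Definition refinement_monoid := forall a0 a1 b0 b1, a0 + a1 = b0 + b1 ->
  exists c00 c01 c10 c11 : M,
    [/\ a0 = c00 + c01, a1 = c10 + c11, b0 = c00 + c10 & b1 = c01 + c11].

Lemma alg_le_refl a : alg_le a a.
Proof. by exists 0; rewrite addr0. Qed.

Lemma alg_le_trans b a c : alg_le a b -> alg_le b c -> alg_le a c.
Proof. by move=> [x <-] [y <-]; exists (x + y); rewrite addrA. Qed.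

Lemma alg_leD a a' b b' : alg_le a b -> alg_le a' b' -> alg_le (a + a') (b + b').
Proof. by move=> [x <-] [y <-]; exists (x + y); rewrite addrACA. Qed.

Lemma alg_leMn n a b : alg_le a b -> alg_le (a *+ n) (b *+ n).
Proof. by move=> [x <-]; exists (x *+ n); rewrite mulrnDl. Qed.

Lemma propto_refl a : propto a a.
Proof. by exists 1%N; split=> //; exact: alg_le_refl. Qed.

Lemma propto_trans b a c : propto a b -> propto b c -> propto a c.
Proof.
move=> [m [m0 ab]] [n [n0 bc]]; exists (n * m)%N; rewrite muln_gt0 m0 n0.
by split=> //; apply: (alg_le_trans ab); rewrite mulrnA; exact: alg_leMn.
Qed.

Lemma propto0 a : propto 0 a.
Proof. by exists 1%N; split=> //; exists a; rewrite add0r. Qed.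

Lemma proptoDl a b : propto a (a + b).
Proof. by exists 1%N; split=> //; exists b. Qed.

Lemma propto_lub a b c : propto (a + b) c <-> propto a c /\ propto b c.
Proof.
split=> [abc|[[m [m0 ac]] [n [n0 bc]]]].
  by split; apply: propto_trans abc; [|rewrite addrC]; exact: proptoDl.
exists (m + n)%N; rewrite addn_gt0 m0; split=> //.
by rewrite mulrnDr; exact: alg_leD.
Qed.

Lemma proptoD a a' b b' : propto a b -> propto a' b' ->
  propto (a + a') (b + b').
Proof.
move=> ab ab'; apply/propto_lub; split.
  by apply: (propto_trans ab); exact: proptoDl.
by apply: (propto_trans ab'); rewrite addrC; exact: proptoDl.
Qed.

Definition asympb : rel M := fun a b => `[< asymp a b >].

Lemma asympb_refl : reflexive asympb.
Proof. by move=> a; apply/asboolP; split; exact: propto_refl. Qed.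

Lemma asympb_sym : symmetric asympb.
Proof. by move=> a b; apply: asbool_equiv_eq; split=> -[]. Qed.

Lemma asympb_trans : transitive asympb.
Proof.
move=> b a c /asboolP[ab ba] /asboolP[bc cb]; apply/asboolP.
by split; [exact: propto_trans bc|exact: propto_trans ba].
Qed.

Canonical asymp_equiv := EquivRel asympb asympb_refl asympb_sym asympb_trans.

Definition nabla := {eq_quot asymp_equiv}.

HB.instance Definition _ := Choice.on nabla.
HB.instance Definition _ := EqQuotient.on nabla.

Lemma pi_nabla_eq a b : \pi_nabla a = \pi_nabla b <-> asymp a b.
Proof.
rewrite (rwP (asboolP (asymp a b))) -[X in is_true X]/(asymp_equiv a b).
by rewrite -eqmodE; split=> /eqP.
Qed.

Lemma asymp_repr a : asymp (repr (\pi_nabla a)) a.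
Proof. by apply/pi_nabla_eq; rewrite reprK. Qed.

Definition nabla_le : rel nabla := fun x y => `[< propto (repr x) (repr y) >].

Definition nabla_join (x y : nabla) : nabla := \pi_nabla (repr x + repr y).

Definition nabla_zero : nabla := \pi_nabla 0.

Lemma nabla_le_refl : reflexive nabla_le.
Proof. by move=> x; apply/asboolP; exact: propto_refl. Qed.

Lemma nabla_le_anti : antisymmetric nabla_le.
Proof.
move=> x y /andP[/asboolP xy /asboolP yx].
by rewrite -[x]reprK -[y]reprK; exact/pi_nabla_eq.
Qed.

Lemma nabla_le_trans : transitive nabla_le.
Proof.
by move=> y x z /asboolP xy /asboolP yz; apply/asboolP; exact: propto_trans yz.
Qed.

Lemma nabla_joinP x y z :
  nabla_le (nabla_join x y) z = nabla_le x z && nabla_le y z.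
Proof.
have [h1 h2] := asymp_repr (repr x + repr y).
rewrite /nabla_le -asbool_and; apply: asbool_equiv_eq.
split=> [xyz|/propto_lub xyz]; last exact: propto_trans xyz.
by apply/propto_lub; apply: propto_trans xyz.
Qed.

Lemma nabla_zero_le x : nabla_le nabla_zero x.
Proof.
apply/asboolP; apply: (@propto_trans 0); last exact: propto0.
by have [] := asymp_repr 0.
Qed.

End Monoids.

Fact nabla_display : Order.disp_t. Proof. exact. Qed.

HB.instance Definition _ (M : nmodType) :=
  Order.Le_isPOrder.Build nabla_display (nabla M)
    (@nabla_le_refl M) (@nabla_le_anti M) (@nabla_le_trans M).
HB.instance Definition _ (M : nmodType) :=
  Order.POrder_isJoinSemilattice.Build nabla_display (nabla M) (@nabla_joinP M).
HB.instance Definition _ (M : nmodType) :=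
  Order.hasBottom.Build nabla_display (nabla M) (@nabla_zero_le M).

Lemma pi_nabla_le (M : nmodType) (a b : M) :
  (\pi_(nabla M) a <= \pi_(nabla M) b)%O <-> propto a b.
Proof.
have [a1 a2] := asymp_repr a; have [b1 b2] := asymp_repr b.
split=> [/asboolP ab|ab].
  by apply: (propto_trans a2); apply: propto_trans b1.
by apply/asboolP; apply: (propto_trans a1); apply: propto_trans b2.
Qed.

Lemma pi_nabla_join (M : nmodType) (a b : M) :
  (\pi_(nabla M) a `|` \pi_(nabla M) b)%O = \pi_(nabla M) (a + b).
Proof.
have [a1 a2] := asymp_repr a; have [b1 b2] := asymp_repr b.
by apply/pi_nabla_eq; split; exact: proptoD.
Qed.

Lemma pi_nabla_bot (M : nmodType) : \pi_(nabla M) 0 = \bot%O.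
Proof. by []. Qed.

Definition semilattice_iso d d' (L : bJoinSemilatticeType d)
    (L' : bJoinSemilatticeType d') :=
  exists f : L -> L',
    [/\ bijective f, f \bot%O = \bot%O
      & {morph f : x y / (x `|` y)%O >-> (x `|` y)%O}].

(* [porderZmodType] does not relate the order to the addition. *)
HB.mixin Record isTranslationInvariant G of Num.POrderedZmodule G := {
  poab_lerD2 : forall x y z : G, x <= y -> x + z <= y + z
}.

#[short(type="poAbGroupType")]
HB.structure Definition POAbGroup :=
  { G of Num.POrderedZmodule G & isTranslationInvariant G }.

Definition nonneg (G : poAbGroupType) : {pred G} := fun x => 0 <= x.
Arguments nonneg : clear implicits.

Lemma nonneg_closed (G : poAbGroupType) : GRing.nmod_closed (nonneg G).
Proof.
split=> [|x y]; rewrite -!topredE /=; first exact: lexx.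
move=> x0 y0; apply: (le_trans y0).
by have := poab_lerD2 0 x y x0; rewrite add0r.
Qed.

Definition pos_cone (G : poAbGroupType) := {x : G | nonneg G x}.

HB.instance Definition _ (G : poAbGroupType) := SubChoice.on (pos_cone G).
HB.instance Definition _ (G : poAbGroupType) :=
  GRing.SubChoice_isSubNmodule.Build G (nonneg G) (pos_cone G)
    (@nonneg_closed G).

Definition interpolation_group (G : poAbGroupType) :=
  refinement_monoid (pos_cone G).

Definition directed_group (G : poAbGroupType) :=
  forall x : G, exists y z : G, [/\ 0 <= y, 0 <= z & x = y + - z].

Definition unperforated (G : poAbGroupType) :=
  forall (m : nat) (x : G), (0 < m)%N -> 0 <= x *+ m -> 0 <= x.

Definition dimension_group (G : poAbGroupType) :=
  [/\ unperforated G, directed_group G & interpolation_group G].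

Definition set_nat_wo : rel (set nat) :=
  sval (wochoice.well_ordering_principle (set nat)).

(* In any well-ordering of an uncountable set, the elements with countably many
   predecessors form an initial segment of order type omega_1; the facts that
   characterize it up to isomorphism among total orders are [omega1_wf], [omega1_uncountable] and
   [omega1_countable_segment]. *)
Definition countable_rank : set (set nat) :=
  [set x | countable [set y | y != x /\ set_nat_wo y x]].

Definition omega1 := {x : set nat | x \in countable_rank}.

HB.instance Definition _ := Choice.on omega1.

Lemma set_nat_woP : wochoice.well_order set_nat_wo.
Proof. exact: svalP (wochoice.well_ordering_principle (set nat)). Qed.

Lemma set_nat_wo_total : total set_nat_wo.
Proof.
move=> x y; have [|z [[]]] := @set_nat_woP [pred u | (u == x) || (u == y)].
  by exists x; rewrite inE eqxx.
rewrite inE => /orP[]/eqP-> zl _; apply/orP.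
  by left; apply: zl; rewrite inE eqxx orbT.
by right; apply: zl; rewrite inE eqxx.
Qed.

Lemma set_nat_wo_refl : reflexive set_nat_wo.
Proof. by move=> x; have /orP[] := set_nat_wo_total x x. Qed.

Lemma set_nat_wo_anti : antisymmetric set_nat_wo.
Proof.
move=> x y /andP[xy yx].
have [|z [_ zuniq]] := @set_nat_woP [pred u | (u == x) || (u == y)].
  by exists x; rewrite inE eqxx.
transitivity z; [symmetry|]; apply: zuniq; split; rewrite ?inE ?eqxx ?orbT//.
  by move=> u; rewrite inE => /orP[]/eqP->//; exact: set_nat_wo_refl.
by move=> u; rewrite inE => /orP[]/eqP->//; exact: set_nat_wo_refl.
Qed.

Lemma set_nat_wo_trans : transitive set_nat_wo.
Proof.
move=> y x z xy yz.
have [|t [[]]] := @set_nat_woP [pred u | [|| u == x, u == y | u == z]].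
  by exists x; rewrite inE eqxx.
rewrite inE => /or3P[]/eqP-> tl _.
- by apply: tl; rewrite inE eqxx !orbT.
- have yx : set_nat_wo y x by apply: tl; rewrite inE eqxx.
  by rewrite (@set_nat_wo_anti x y) // xy yx.
- have zy : set_nat_wo z y by apply: tl; rewrite inE eqxx orbT.
  by rewrite -(@set_nat_wo_anti y z) // yz zy.
Qed.

Definition omega1_le : rel omega1 := fun x y => set_nat_wo (val x) (val y).

Lemma omega1_le_refl : reflexive omega1_le.
Proof. by move=> x; exact: set_nat_wo_refl. Qed.

Lemma omega1_le_anti : antisymmetric omega1_le.
Proof. by move=> x y xy; apply: val_inj; exact: set_nat_wo_anti. Qed.

Lemma omega1_le_trans : transitive omega1_le.
Proof. by move=> y x z; exact: set_nat_wo_trans. Qed.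

Lemma omega1_le_total : total omega1_le.
Proof. by move=> x y; exact: set_nat_wo_total. Qed.

Fact omega1_display : Order.disp_t. Proof. exact. Qed.

HB.instance Definition _ := Order.Le_isPOrder.Build omega1_display omega1
  omega1_le_refl omega1_le_anti omega1_le_trans.
HB.instance Definition _ := Order.POrder_isTotal.Build omega1_display omega1
  omega1_le_total.

Lemma omega1_wf : well_founded (fun x y : omega1 => (x < y)%O).
Proof.
move=> x; apply: contrapT => nx.
pose A := [pred u : set nat | `[< exists2 w : omega1, val w = u &
  ~ Acc (fun x y : omega1 => (x < y)%O) w >]].
have [|u [[/asboolP[w wu nw] ul] _]] := @set_nat_woP A.
  by exists (val x); apply/asboolP; exists x.
apply: nw; constructor => y yw; apply: contrapT => ny.
have : (w <= y)%O.
  rewrite /Order.le /= /omega1_le wu; apply: ul.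
  by apply/asboolP; exists y.
by rewrite leNgt yw.
Qed.

Lemma omega1_countable_segment (a : omega1) :
  countable [set b : omega1 | (b < a)%O].
Proof.
have /set_mem /countable_injP [f finj] := valP a.
apply/countable_injP; exists (f \o val) => b c /set_mem ba /set_mem ca /=.
have segP (u : omega1) : (u < a)%O ->
    val u \in [set y | y != val a /\ set_nat_wo y (val a)].
  move=> ua; apply/mem_set; split; last exact: (ltW ua : omega1_le u a).
  by apply: contraTneq ua => /val_inj->; rewrite ltxx.
by move=> /finj eqbc; apply: val_inj; apply: eqbc; exact: segP.
Qed.

Lemma set_nat_uncountable : ~ countable [set: set nat].
Proof.
move=> /countable_injP[f finj].
pose D := [set n | exists2 A : set nat, f A = n & ~ A n].
have fK A B : f A = f B -> A = B by move=> AB; apply: finj => //; exact: in_setT.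
have [DfD|nDfD] := pselect (D (f D)).
  by have [A /fK AD nA] := DfD; apply: nA; rewrite AD.
by apply: (nDfD); exists D.
Qed.

Lemma omega1_uncountable : ~ countable [set: omega1].
Proof.
move=> /countable_injP[f finj].
have cR : countable countable_rank.
  have -> : countable_rank = [set val x | x in [set: omega1]].
    apply/seteqP; split=> [x Rx|_ [x _ <-]]; last exact/set_mem/(valP x).
    by exists (Sub x (mem_set Rx)).
  by apply: (card_le_trans (card_image_le _ _)); apply/countable_injP; exists f.
have [RT|] := pselect (countable_rank = setT).
  by apply: set_nat_uncountable; rewrite -RT.
move=> RT.
have [|u [[nRu ul] _]] := @set_nat_woP [pred u | u \notin countable_rank].
  apply: contrapT => nex; apply: RT; apply/seteqP; split=> // x _.
  by apply: contrapT => nRx; apply: nex; exists x; rewrite inE notin_setE.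
move: nRu; rewrite inE notin_setE; apply.
apply: sub_countable cR; apply: subset_card_le => y [yu ylu].
apply: contrapT => nRy; move/eqP: yu; apply; apply: set_nat_wo_anti.
by rewrite ylu ul// inE notin_setE.
Qed.

Definition boolean_subalgebra T (B : set (set T)) :=
  [/\ B set0, B setT, forall x, B x -> B (~` x),
      forall x y, B x -> B y -> B (x `|` y)
    & forall x y, B x -> B y -> B (x `&` y)].

(* Formal intervals, with possibly infinite bounds, account for all convex
   subsets of a well-ordered set. *)
Definition B_omega1 : set (set omega1) :=
  smallest (@boolean_subalgebra omega1)
    [set x | exists i : interval omega1, x = [set` i]].

(* The ordinal [a], as the set of smaller ordinals. *)
Definition ord_set (a : omega1) : set omega1 := [set b | (b < a)%O].

Definition I_omega1 : set (set omega1) :=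
  [set x | B_omega1 x /\ exists a, x `<=` ord_set a].

Definition F_omega1 : set (set omega1) :=
  [set x | B_omega1 x /\ exists a, ~` ord_set a `<=` x].

Definition D_omega1 : set (set omega1) :=
  [set x | finite_set x \/ x = setT].

Definition Dm_omega1 : set (set omega1) := D_omega1 `\` [set set0].

Definition S_omega1_set : set (set omega1 * set omega1) :=
  ([set set0] `*` I_omega1) `|` (Dm_omega1 `*` F_omega1).

Definition S_omega1 := {p : set omega1 * set omega1 | p \in S_omega1_set}.

HB.instance Definition _ := SubChoice.on S_omega1.

Lemma B_omega1U x y : B_omega1 x -> B_omega1 y -> B_omega1 (x `|` y).
Proof.
move=> Bx By A [AB iA]; have [_ _ _ AU _] := AB.
by apply: AU; [apply: Bx|apply: By].
Qed.

Lemma B_omega1_0 : B_omega1 set0.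
Proof. by move=> A [[]]. Qed.

Lemma I_omega1_0 : I_omega1 set0.
Proof.
split; first exact: B_omega1_0.
have [a _] : [set: omega1] !=set0; last by exists a.
by apply/set0P; apply/eqP => T0; apply: omega1_uncountable; rewrite T0.
Qed.

Lemma I_omega1U x y : I_omega1 x -> I_omega1 y -> I_omega1 (x `|` y).
Proof.
move=> [Bx [a xa]] [By [b yb]]; split; first exact: B_omega1U.
exists (Order.max a b) => z [/xa|/yb]; rewrite /ord_set /= lt_max => ->//.
by rewrite orbT.
Qed.

Lemma F_omega1Ul x y : F_omega1 x -> B_omega1 y -> F_omega1 (x `|` y).
Proof.
move=> [Bx [a xa]] By; split; first exact: B_omega1U.
by exists a => z /xa; left.
Qed.

Lemma Dm_omega1U x y : Dm_omega1 x -> D_omega1 y -> Dm_omega1 (x `|` y).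
Proof.
move=> [Dx x0] Dy; split; last first.
  move=> xy0; have [/x0 //] : x = set0 /\ y = set0 by rewrite -setU_eq0.
case: Dx => [fx|->]; last by right; rewrite setTU.
by case: Dy => [fy|->]; [left; rewrite finite_setU|right; rewrite setUT].
Qed.

Lemma S_omega1U p q : S_omega1_set p -> S_omega1_set q ->
  S_omega1_set (p.1 `|` q.1, p.2 `|` q.2).
Proof.
move=> [[/= p1 Ip]|[Dp Fp]] [[/= q1 Iq]|[Dq Fq]].
- by left; split=> /=; [rewrite p1 q1 setU0|exact: I_omega1U].
- by right; split=> /=; [rewrite p1 set0U|rewrite setUC; apply: F_omega1Ul Ip.1].
- by right; split=> /=; [rewrite q1 setU0|apply: F_omega1Ul Iq.1].
- by right; split=> /=; [apply: Dm_omega1U Dq.1|apply: F_omega1Ul Fq.1].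
Qed.

Definition S_le : rel S_omega1 := fun p q =>
  `[< (val p).1 `<=` (val q).1 /\ (val p).2 `<=` (val q).2 >].

Definition S_join (p q : S_omega1) : S_omega1 :=
  Sub ((val p).1 `|` (val q).1, (val p).2 `|` (val q).2)
    (mem_set (S_omega1U (set_mem (valP p)) (set_mem (valP q)))).

Lemma S_zero_subproof : S_omega1_set (set0, set0).
Proof. by left; split=> //; exact: I_omega1_0. Qed.

Definition S_zero : S_omega1 := Sub (set0, set0) (mem_set S_zero_subproof).

Lemma S_le_refl : reflexive S_le.
Proof. by move=> p; apply/asboolP; split. Qed.

Lemma S_le_anti : antisymmetric S_le.
Proof.
move=> p q /andP[/asboolP[pq1 pq2] /asboolP[qp1 qp2]]; apply: val_inj.
by case: (val p) (val q) pq1 pq2 qp1 qp2 => [A x] [A' x'] /= *;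
  congr (_, _); apply/seteqP.
Qed.

Lemma S_le_trans : transitive S_le.
Proof.
move=> q p r /asboolP[pq1 pq2] /asboolP[qr1 qr2]; apply/asboolP.
by split; [apply: subset_trans qr1|apply: subset_trans qr2].
Qed.

Lemma S_joinP p q r : S_le (S_join p q) r = S_le p r && S_le q r.
Proof.
rewrite /S_le -asbool_and; apply: asbool_equiv_eq; rewrite !SubK /= !subUset.
by split=> [[[? ?] [? ?]]|[[? ?] [? ?]]].
Qed.

Lemma S_zero_le p : S_le S_zero p.
Proof. by apply/asboolP; rewrite SubK; split; exact: sub0set. Qed.

Fact S_display : Order.disp_t. Proof. exact. Qed.

HB.instance Definition _ :=
  Order.Le_isPOrder.Build S_display S_omega1 S_le_refl S_le_anti S_le_trans.
HB.instance Definition _ :=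
  Order.POrder_isJoinSemilattice.Build S_display S_omega1 S_joinP.
HB.instance Definition _ :=
  Order.hasBottom.Build S_display S_omega1 S_zero_le.

(* Main.v *)
(* Let [e] be an element of [M] whose class is the top of [S_omega1]. For each
   [alpha], Riesz decomposition yields [a_alpha <= e] whose class has first
   component [{alpha}], and second component containing a final segment of
   [omega_1]. Each point [xi] defines the ideal of those [v] whose second
   component misses [xi]. For [xi] large enough, [e <= n a_alpha] holds modulo
   the ideal of [xi], with [n] uniform on bounded sets of points; since every
   sequence in [omega_1] is bounded, some [n_alpha] works for all large [xi].
   Infinitely many [alpha] share the same [n]. As the [a_alpha] are pairwise
   disjoint modulo elements of bounded support, any [n + 1] of these add up to at
   most [e] modulo the ideal of a large [xi], whence [(n + 1) e <= n e] modulo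
   that ideal. Strong separativity then puts [e] itself in the ideal, a
   contradiction. *)
Require Import Defs.
From mathcomp Require Import all_boot all_order all_algebra.
From mathcomp Require Import all_classical.

Set Implicit Arguments.
Unset Strict Implicit.
Unset Printing Implicit Defensive.

Import Order.TTheory GRing.Theory Num.Theory.

Local Open Scope classical_set_scope.
Local Open Scope ring_scope.

(** * Cancellation under strong separativity *)

Lemma alg_leDr (M : nmodType) (a b : M) : alg_le a (a + b).
Proof. by exists b. Qed.

(** Adding a complement of [c] in [b *+ n] reduces to cancelling [b *+ n]; copies of [b] then come
    off one at a time, by strong separativity for [a + b *+ k] and [b + b *+ k]. *)
Lemma strongly_separative_cancel (M : nmodType) (a b c : M) :
  strongly_separative M -> a + c = b + c -> propto c b -> a = b.
Proof.
move=> ssM abc [n [_ [d cd]]].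
have {abc cd d c} : a + b *+ n = b + b *+ n by rewrite -cd !addrA abc.
elim: n => [|n IHn]; first by rewrite !addr0.
rewrite !mulrS => abn; apply: IHn; apply: ssM.
by rewrite mulr2n addrAC abn addrAC.
Qed.

Lemma strongly_separative_absorb (M : nmodType) (e w : M) n :
  strongly_separative M -> alg_le (e *+ n.+1) (e *+ n + w) -> alg_le e w.
Proof.
move=> ssM [t]; rewrite mulrS => et.
(* An extra [e] on both sides makes the right side dominate [e *+ n], as cancellation requires; [w]
   alone need not. *)
have eewe : e + e + t = w + e.
  apply: (@strongly_separative_cancel _ _ _ (e *+ n) ssM).
    rewrite [RHS](ACl (2 * 3 * 1)) -[RHS]addrA -et.
    by rewrite (ACl (1 * 2 * 4 * 3)) !addrA.
  elim: n {et} => [|n IHn]; first exact: propto0.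
  rewrite mulrS; apply/propto_lub; split=> //.
  by rewrite addrC; exact: proptoDl.
exists t; apply/esym/(@strongly_separative_cancel _ _ _ e ssM).
  by rewrite -eewe addrAC.
exact: proptoDl.
Qed.

(** * Countability in [omega1] *)

(** Otherwise countably many countable initial segments would cover [omega1]. *)
Lemma omega1_sequence_bounded (x : nat -> omega1) :
  exists l : omega1, forall n, (x n < l)%O.
Proof.
apply: contrapT => nbound; apply: omega1_uncountable.
apply: (@sub_countable _ _ _ (\bigcup_n ([set b | (b < x n)%O] `|` [set x n]))).
  apply: subset_card_le => l _; apply: contrapT => nl; apply: nbound.
  exists l => n; rewrite ltNge le_eqVlt; apply/negP => lx; apply: nl.
  by exists n => //; case/orP: lx => [/eqP|]; [right|left].
apply: bigcup_countable => // n _.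
rewrite -bigcup2E; apply: bigcup_countable => // -[|[|i]] _ /=.
- exact: omega1_countable_segment.
- exact/finite_set_countable/finite_set1.
- exact/finite_set_countable/finite_set0.
Qed.

Lemma omega1_infinite_fiber (f : omega1 -> nat) :
  exists n, infinite_set [set a | f a = n].
Proof.
apply: contrapT => fin; apply: omega1_uncountable.
apply: (@sub_countable _ _ _ (\bigcup_n [set a | f a = n])).
  by apply: subset_card_le => a _; exists (f a).
apply: bigcup_countable => // n _; apply: finite_set_countable.
by apply: contrapT => infn; apply: fin; exists n.
Qed.

Lemma infinite_set_uniq_seq (T : choiceType) (A : set T) n :
  infinite_set A ->
  exists s : seq T, [/\ size s = n, uniq s & forall x, x \in s -> A x].
Proof.
move=> infA; elim: n => [|n [s [sn us sA]]]; first by exists [::].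
have [x [Ax xs]] : exists x, A x /\ x \notin s.
  apply: contrapT => nx; apply: infA.
  apply: (@sub_finite_set _ _ [set` s]); last exact: finite_seq.
  by move=> x Ax /=; apply: contrapT => /negP xs; apply: nx; exists x.
exists (x :: s); rewrite /= sn xs us; split=> // y.
by rewrite inE => /orP[/eqP->|/sA].
Qed.

Lemma B_omega1_itv (i : interval omega1) : B_omega1 [set` i].
Proof. by move=> A [_]; apply; exists i. Qed.

Lemma B_omega1C x : B_omega1 x -> B_omega1 (~` x).
Proof.
by move=> Bx A AG; have [[_ _ A_C _ _] _] := AG; apply: A_C; exact: Bx.
Qed.

Lemma B_omega1T : B_omega1 setT.
Proof. by rewrite -setC0; exact: B_omega1C B_omega1_0. Qed.

(* [supp a] stands for the image of the class of [a] under an isomorphism of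
   [nabla M] onto [S_omega1]. *)
Section Support.
Variables (M : nmodType) (supp : M -> set omega1 * set omega1).
Hypothesis ssM : strongly_separative M.
Hypothesis refM : refinement_monoid M.
Hypothesis suppS : forall a, S_omega1_set (supp a).
Hypothesis supp0 : supp 0 = (set0, set0).
Hypothesis suppD1 : forall a b, (supp (a + b)).1 = (supp a).1 `|` (supp b).1.
Hypothesis suppD2 : forall a b, (supp (a + b)).2 = (supp a).2 `|` (supp b).2.
Hypothesis supp_surj : forall p, S_omega1_set p -> exists a, supp a = p.
Hypothesis supp_propto : forall a b,
  (supp a).1 `<=` (supp b).1 -> (supp a).2 `<=` (supp b).2 -> propto a b.

(** * Supports and decompositions in [M] *)

Let supp1_le a b : alg_le a b -> (supp a).1 `<=` (supp b).1.
Proof. by move=> [c <-]; rewrite suppD1; exact: subsetUl. Qed.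

Let supp2_le a b : alg_le a b -> (supp a).2 `<=` (supp b).2.
Proof. by move=> [c <-]; rewrite suppD2; exact: subsetUl. Qed.

Let supp2_mulrn a n : (supp (a *+ n)).2 `<=` (supp a).2.
Proof.
elim: n => [|n IHn]; first by rewrite mulr0n supp0.
by rewrite mulrS suppD2 subUset; split.
Qed.

Let supp1_bounded a : (supp a).1 = set0 -> exists z, (supp a).2 `<=` ord_set z.
Proof.
move=> a0; have [[_ [_ //]]|[[_ na0] _]] := suppS a.
by case: na0.
Qed.

Let supp1_cofinal a x : (supp a).1 x -> exists z, ~` ord_set z `<=` (supp a).2.
Proof.
move=> ax; have [[a0 _]|[_ [_ //]]] := suppS a.
by move: ax; rewrite a0.
Qed.

(** Refinement cuts [a] into pieces below [e]; supports of sums are unions, so some piece keeps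
    [x]. *)
Lemma support1_riesz x a e n : alg_le a (e *+ n) -> (supp a).1 x ->
  exists b, [/\ alg_le b a, alg_le b e & (supp b).1 x].
Proof.
elim: n a => [|n IHn] a; first by move=> /supp1_le; rewrite mulr0n supp0 => s /s.
move=> [z]; rewrite mulrS => /refM[c00 [c01 [c10 [c11 [-> _ e0 en]]]]].
rewrite suppD1 => -[x0|x1].
  by exists c00; split=> //; [|rewrite e0]; exact: alg_leDr.
have [|b [bc be bx]] := IHn c01 _ x1; first by rewrite en; exact: alg_leDr.
exists b; split=> //; apply: (alg_le_trans bc).
by rewrite addrC; exact: alg_leDr.
Qed.

Lemma support1_atom e x : supp e = (setT, setT) ->
  exists a, alg_le a e /\ (supp a).1 = [set x].
Proof.
move=> eT; have [|a aE] := supp_surj (p := ([set x], setT)).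
  right; split; split=> /=.
  - by left; exact: finite_set1.
  - by move=> x0; have : [set x] x by []; rewrite x0.
  - exact: B_omega1T.
  - by exists x.
have [n [_ ane]] : propto a e by apply: supp_propto; rewrite eT; exact: subsetT.
have [|b [ba be bx]] := support1_riesz ane (x := x); first by rewrite aE.
exists b; split=> //; apply/seteqP; split=> [y|_ ->//].
by move/(supp1_le ba); rewrite aE.
Qed.

(** Diagonal argument: if each [n] fails at some [t n], a single [v] whose second component misses
    all these points still gives [a + v] full support, so some [n] works at its own [t n]. *)
Lemma uniform_bound_at_infinity e a x : supp e = (setT, setT) -> (supp a).1 x ->
  exists n z, forall t, (z <= t)%O ->
    exists2 v, ~ (supp v).2 t & alg_le e (a *+ n + v).
Proof.
move=> eT /supp1_cofinal[z za].
apply: contrapT => nuni.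
have /choice[t tP] : forall n, exists t, (z <= t)%O /\
    ~ exists2 v, ~ (supp v).2 t & alg_le e (a *+ n + v).
  move=> n; apply: contrapT => nt; apply: nuni; exists n, z => t zt.
  by apply: contrapT => nv; apply: nt; exists t.
have [l tl] := omega1_sequence_bounded t.
(* The removed interval contains every [t n] and lies in the second component of [a]; being bounded,
   it has its complement in [F_omega1]. *)
have [|v vE] := supp_surj (p := (setT, ~` [set` `[z, l[])).
  right; split; split=> /=.
  - by right.
  - by move=> T0; have : setT z by []; rewrite T0.
  - by apply: B_omega1C; exact: B_omega1_itv.
  - by exists l => y /= yl; rewrite in_itv /= => /andP[_].
have [| |n [_ en]] := @supp_propto e (a + v).
- by rewrite suppD1 vE setUT.
- rewrite suppD2 vE eT => y _ /=.
  have [/za|yz] := pselect ((~` ord_set z) y); first by left.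
  right; rewrite in_itv /= => /andP[zy _]; apply: yz.
  by rewrite /ord_set /= ltNge zy.
have [zt] := tP n; apply; exists (v *+ n); last by rewrite -mulrnDl.
move=> /supp2_mulrn; rewrite vE /=; apply.
by rewrite in_itv /= zt tl.
Qed.

Lemma disjoint_sum_le (e : M) (a : omega1 -> M) (s : seq omega1) :
  (forall x, alg_le (a x) e) -> (forall x, (supp (a x)).1 = [set x]) -> uniq s ->
  exists2 u, (supp u).1 = set0 & alg_le (\sum_(x <- s) a x) (e + u).
Proof.
move=> ae aE; elim: s => [_|x s IHs /= /andP[xs /IHs[u u0 [p]]]].
  by exists 0; [rewrite supp0|rewrite big_nil; exists (e + 0); rewrite add0r].
have s1 : (supp (\sum_(y <- s) a y)).1 `<=` [set` s].
  elim: s {IHs xs} => [|y s IHs]; first by rewrite big_nil supp0.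
  rewrite big_cons suppD1 aE => z /= [->|/IHs /= zs]; first by rewrite inE eqxx.
  by rewrite inE zs orbT.
rewrite big_cons; have [b be] := ae x.
move: s1; set S := \sum_(y <- s) _ => s1 spe.
(* The overlap [c00] of [S] and [a x] has first component inside both [s] and [{x}], hence empty; it
   can be added to [u]. *)
have : S + p = a x + (b + u) by rewrite addrA be.
move=> /refM[c00 [c01 [c10 [c11 [SE pE xE _]]]]].
exists (u + c00).
  rewrite suppD1 u0 set0U; apply/seteqP; split=> // y yc.
  have : (supp (a x)).1 y by rewrite xE suppD1; left.
  rewrite aE => /= yx; move/negP: xs; apply; rewrite -yx; apply: s1.
  by rewrite SE suppD1; left.
exists c11; rewrite [RHS]addrA -spe pE xE.
by rewrite [LHS](ACl (3 * 2 * 4 * 1)) [in RHS]addrA.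
Qed.

Lemma no_support_map : False.
Proof.
have [_ [z0 _]] := I_omega1_0.
have [|e eT] := supp_surj (p := (setT, setT)).
  right; split; split=> /=.
  - by right.
  - by move=> T0; have : setT z0 by []; rewrite T0.
  - exact: B_omega1T.
  - by exists z0.
have /choice[a aP] := fun x => support1_atom x eT.
have aE x : (supp (a x)).1 = [set x] by have [] := aP x.
have ae x : alg_le (a x) e by have [] := aP x.
have /choice[n /choice[z zP]] : forall x, exists n z, forall t, (z <= t)%O ->
    exists2 v, ~ (supp v).2 t & alg_le e (a x *+ n + v).
  by move=> x; apply: (@uniform_bound_at_infinity _ _ x) => //; rewrite aE.
have [m minf] := omega1_infinite_fiber n.
(* One index more than the common multiplicity [m] yields the surplus copy of [e]. *)
have [s [sm us sP]] := infinite_set_uniq_seq m.+1 minf.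
have [u u0 sle] := disjoint_sum_le ae aE us.
have [y uy] := supp1_bounded u0.
(* The point [t] lies beyond the second component of [u] and past the threshold of each index in
   [s]. *)
have [t ty tz] : exists2 t, (y <= t)%O & forall x, x \in s -> (z x <= t)%O.
  elim: {sm us sP sle} s => [|x s [t yt tz]]; first by exists y.
  exists (Order.max (z x) t); first by rewrite le_max yt orbT.
  move=> x'; rewrite inE le_max => /orP[/eqP->|/tz ->]; first by rewrite lexx.
  by rewrite orbT.
have [w wt ew] : exists2 w, ~ (supp w).2 t &
    alg_le (e *+ size s) ((\sum_(x <- s) a x) *+ m + w).
  elim: {sm us sle} s sP tz => [|x s IHs] sP tz.
    exists 0; first by rewrite supp0.
    by rewrite big_nil mul0rn addr0; exact: alg_le_refl.
  have [x' xs|x' xs|w wt ew] := IHs; [by apply: sP; rewrite inE xs orbT|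
    by apply: tz; rewrite inE xs orbT|].
  have [|v vt ev] := zP x t; first by apply: tz; rewrite inE eqxx.
  exists (v + w); first by rewrite suppD2 => -[].
  rewrite big_cons mulrnDl addrACA /= mulrS; apply: alg_leD => //.
  by rewrite -(sP x) ?inE ?eqxx.
have : alg_le (e *+ m.+1) (e *+ m + (u *+ m + w)).
  rewrite -sm; apply: (alg_le_trans ew); rewrite addrA -mulrnDl.
  by apply: alg_leD; [exact: alg_leMn|exact: alg_le_refl].
(* Now [e] is below [u *+ m + w], whose second component misses [t]. *)
move=> /(strongly_separative_absorb ssM)/supp2_le.
rewrite eT suppD2 => /(_ t I)[/supp2_mulrn/uy|//].
by rewrite /ord_set /= ltNge ty.
Qed.

End Support.

(** * Transfer to [nabla M] and to positive cones *)

Lemma no_strongly_separative (M : nmodType) :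
  strongly_separative M -> refinement_monoid M ->
  ~ semilattice_iso (nabla M) S_omega1.
Proof.
move=> ssM refM [f [fbij f0 fD]].
pose supp (a : M) : set omega1 * set omega1 := val (f (\pi_(nabla M) a)%qT).
have suppD a b :
    supp (a + b) = ((supp a).1 `|` (supp b).1, (supp a).2 `|` (supp b).2).
  by rewrite /supp -pi_nabla_join fD.
apply: (@no_support_map M supp) => //.
- by move=> a; exact/set_mem/valP.
- by rewrite /supp pi_nabla_bot f0.
- by move=> a b; rewrite suppD.
- by move=> a b; rewrite suppD.
- move=> p Sp; have [g gK fK] := fbij.
  by exists (repr (g (Sub p (mem_set Sp)))); rewrite /supp reprK fK SubK.
(* The isomorphism is only known to preserve joins and bottom, so the order is recovered from
   joins. *)
- move=> a b ab1 ab2; apply/pi_nabla_le/join_idPl/(bij_inj fbij).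
  by rewrite fD; apply/join_idPl/asboolP.
Qed.

Lemma pos_cone_strongly_separative (G : poAbGroupType) :
  strongly_separative (pos_cone G).
Proof.
move=> a b; rewrite mulr2n => /(congr1 val); rewrite !raddfD /= => /addIr.
exact: val_inj.
Qed.

Theorem corollary5p3 :
  (~ exists M : nmodType,
       [/\ strongly_separative M, refinement_monoid M
         & semilattice_iso (nabla M) S_omega1]) /\
  (~ exists G : poAbGroupType,
       interpolation_group G /\ semilattice_iso (nabla (pos_cone G)) S_omega1) /\
  (~ exists G : poAbGroupType,
       dimension_group G /\ semilattice_iso (nabla (pos_cone G)) S_omega1).
Proof.
split; first by case=> M [ssM refM]; exact: no_strongly_separative.
have noG (G : poAbGroupType) : interpolation_group G ->
    ~ semilattice_iso (nabla (pos_cone G)) S_omega1.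
  exact/no_strongly_separative/pos_cone_strongly_separative.
split; first by case=> G [iG]; exact: noG.
by case=> G [[_ _ iG]]; exact: noG.
Qed.
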